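(* Given are an ellipse $\varepsilon$ and a parabola $p$ of a common focus $F$ (in the same plane). Then, when $p$ rotates about $F$ (with $\varepsilon$ fixed), the common chord of $\varepsilon$ and $p$ (for all positions of $p$ for which it exists) is tangent to some fixed conic $\gamma$.
   Context: The common chord of $\varepsilon$ and a given position of $p$ is the chord joining their two intersection points, and it exists when the two curves meet in two distinct points. Tangency of the chord to $\gamma$ means tangency of the straight line containing it. The conic $\gamma$ is the same for all positions of $p$.
   Formalization: When the ellipse and the parabola have equal semi-latera recta, every line through F is a common chord and no proper conic touches them all; in exactly that case the conic γ may degenerate to the point F, tangency then meaning passing through F. *)

(* Defs.v *)
From Stdlib Require Import Reals.
Open Scope R_scope.

Definition point : Type := (R * R)%type.

Definition pdist (X Y : point) : R := dist_euc (fst X) (snd X) (fst Y) (snd Y).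

Record line : Type := Line {
  la : R; lb : R; lc : R;
  line_nz : la <> 0 \/ lb <> 0 }.

Definition line_eval (l : line) (X : point) : R :=
  la l * fst X + lb l * snd X + lc l.

Definition on_line (l : line) (X : point) : Prop := line_eval l X = 0.

Definition dist_line (X : point) (l : line) : R :=
  Rabs (line_eval l X) / sqrt (la l ^ 2 + lb l ^ 2).

(* Second focus [F'] and major axis [2 * a]; a genuine ellipse when
   [pdist F F' < 2 * a].  The choice [F' = F] gives the circles centred at F. *)
Definition ellipse (F F' : point) (a : R) (X : point) : Prop :=
  pdist X F + pdist X F' = 2 * a.

(* A genuine parabola when [F] is not on the directrix [d]. *)
Definition parabola (F : point) (d : line) (X : point) : Prop :=
  pdist X F = dist_line X d.

(* Usual b^2 / a, with b^2 = a^2 - c^2 and 2 * c the distance of the foci. *)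
Definition ellipse_semi_latus_rectum (F F' : point) (a : R) : R :=
  (a ^ 2 - (pdist F F' / 2) ^ 2) / a.

Definition parabola_semi_latus_rectum (F : point) (d : line) : R :=
  dist_line F d.

Definition rotate (F : point) (theta : R) (X : point) : point :=
  (fst F + cos theta * (fst X - fst F) - sin theta * (snd X - snd F),
   snd F + sin theta * (fst X - fst F) + cos theta * (snd X - snd F)).

Definition rotated (F : point) (theta : R) (S : point -> Prop) (X : point) :
  Prop := exists Y : point, S Y /\ X = rotate F theta Y.

(* The equation  qxx x^2 + 2 qxy x y + qyy y^2 + 2 qx x + 2 qy y + q0 = 0. *)
Record quadric : Type := Quadric {
  qxx : R; qxy : R; qyy : R; qx : R; qy : R; q0 : R }.

Definition quadric_eval (g : quadric) (X : point) : R :=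
  qxx g * fst X ^ 2 + 2 * qxy g * fst X * snd X + qyy g * snd X ^ 2
  + 2 * qx g * fst X + 2 * qy g * snd X + q0 g.

Definition on_quadric (g : quadric) (X : point) : Prop := quadric_eval g X = 0.

Definition quadric_grad (g : quadric) (X : point) : point :=
  (2 * qxx g * fst X + 2 * qxy g * snd X + 2 * qx g,
   2 * qxy g * fst X + 2 * qyy g * snd X + 2 * qy g).

(* Determinant of the symmetric matrix
   ((qxx, qxy, qx), (qxy, qyy, qy), (qx, qy, q0)). *)
Definition quadric_det (g : quadric) : R :=
  qxx g * (qyy g * q0 g - qy g * qy g)
  - qxy g * (qxy g * q0 g - qy g * qx g)
  + qx g * (qxy g * qy g - qyy g * qx g).

(* Ellipses, parabolas and hyperbolas: the nonzero determinant excludes line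
   pairs, double lines and single points, the second condition the imaginary
   ellipses. *)
Definition proper_conic (g : quadric) : Prop :=
  quadric_det g <> 0 /\ exists X : point, on_quadric g X.

(* The degenerate conic (an ellipse of size zero) consisting of [P] alone. *)
Definition point_conic (P : point) (g : quadric) : Prop :=
  forall X : point, on_quadric g X <-> X = P.

(* The line meets the conic at [T] with multiplicity at least two: the
   gradient at [T] is orthogonal to the direction (- lb, la) of the line.  The
   gradient does not vanish on a proper conic, so there the line is the tangent
   at [T]; it vanishes at the point of a point conic, for which tangency thus
   means passing through that point. *)
Definition tangent (l : line) (g : quadric) : Prop :=
  exists T : point, on_line l T /\ on_quadric g T /\
    fst (quadric_grad g T) * (- lb l) + snd (quadric_grad g T) * la l = 0.

(* Main.v *)
Require Import Defs.
From Stdlib Require Import Reals.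
From Stdlib Require Import Psatz.
Open Scope R_scope.

(** In focal form, with [r] the distance to [F] and [X] measured from [F], the
    ellipse is [r = L + e.X] with [|e| < 1] and the rotated parabola is
    [r = p + u.X] with [u] a unit vector.  Subtracting, the common chord lies on
    [(u - e).X = k] with [k = L - p] independent of the rotation.  The envelope
    of these lines over all unit vectors [u] is [r^2 = (k + e.X)^2]: the line for
    [u] touches it at [k u / (1 - e.u)].  For [k = 0] it shrinks to [F]. *)

(** * Distances and vectors in the plane *)

Definition inner_from (F v X : point) : R :=
  fst v * (fst X - fst F) + snd v * (snd X - snd F).

Lemma pdist_ge0 (X Y : point) : 0 <= pdist X Y.
Proof. apply sqrt_pos. Qed.

Lemma pdist_sqr (X Y : point) :
  pdist X Y ^ 2 = (fst X - fst Y) ^ 2 + (snd X - snd Y) ^ 2.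
Proof.
  unfold pdist, dist_euc; rewrite pow2_sqrt.
  - unfold Rsqr; ring.
  - apply Rplus_le_le_0_compat; apply Rle_0_sqr.
Qed.

Lemma cauchy_schwarz (x y x' y' : R) :
  (x * x' + y * y') ^ 2 <= (x ^ 2 + y ^ 2) * (x' ^ 2 + y' ^ 2).
Proof. pose proof (pow2_ge_0 (x * y' - y * x')); nra. Qed.

(** In the plane the vectors orthogonal to a nonzero vector form a line. Multiplying by a nonzero
    coordinate of [n] avoids a division. *)
Lemma orthogonal_parallel (nx ny vx vy wx wy : R) :
  nx <> 0 \/ ny <> 0 ->
  nx * vx + ny * vy = 0 -> nx * wx + ny * wy = 0 -> vx * wy = vy * wx.
Proof.
  intros [Hn | Hn] Hv Hw.
  - apply (Rmult_eq_reg_l nx); [|exact Hn].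
    replace (nx * (vx * wy)) with (- ny * vy * wy + wy * (nx * vx + ny * vy)) by ring.
    replace (nx * (vy * wx)) with (- ny * vy * wy + vy * (nx * wx + ny * wy)) by ring.
    rewrite Hv, Hw; ring.
  - apply (Rmult_eq_reg_l ny); [|exact Hn].
    replace (ny * (vx * wy)) with (- nx * vx * wx + vx * (nx * wx + ny * wy)) by ring.
    replace (ny * (vy * wx)) with (- nx * vx * wx + wx * (nx * vx + ny * vy)) by ring.
    rewrite Hv, Hw; ring.
Qed.

(** * Focal equations of the ellipse and of the rotated parabola *)

Definition eccentricity_vector (F F' : point) (a : R) : point :=
  ((fst F' - fst F) / (2 * a), (snd F' - snd F) / (2 * a)).

(** Squaring [pdist X F' = 2 * a - pdist X F] cancels the quadratic terms and leaves a relation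
    linear in [pdist X F] and [X]. *)
Lemma ellipse_focal (F F' : point) (a : R) (X : point) :
  0 < a -> ellipse F F' a X ->
  pdist X F = ellipse_semi_latus_rectum F F' a
              + inner_from F (eccentricity_vector F F' a) X.
Proof.
  intros Ha HX; unfold ellipse in HX.
  pose proof (pdist_sqr X F) as H1; pose proof (pdist_sqr X F') as H2.
  pose proof (pdist_sqr F F') as H3.
  replace (pdist X F') with (2 * a - pdist X F) in H2 by lra.
  unfold ellipse_semi_latus_rectum, inner_from, eccentricity_vector; simpl fst; simpl snd.
  apply (Rmult_eq_reg_l (4 * a)); [|lra].
  field_simplify; [|lra].
  rewrite H3; nra.
Qed.

Lemma eccentricity_lt1 (F F' : point) (a : R) :
  pdist F F' < 2 * a ->
  fst (eccentricity_vector F F' a) ^ 2 + snd (eccentricity_vector F F' a) ^ 2 < 1.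
Proof.
  intros H; pose proof (pdist_ge0 F F') as H0; pose proof (pdist_sqr F F') as H1.
  unfold eccentricity_vector; simpl fst; simpl snd.
  apply (Rmult_lt_reg_l ((2 * a) ^ 2)); [nra|].
  field_simplify; [nra|lra].
Qed.

Lemma semi_latus_rectum_gt0 (F : point) (d : line) :
  ~ on_line d F -> 0 < parabola_semi_latus_rectum F d.
Proof.
  intros H; apply Rdiv_lt_0_compat; [now apply Rabs_pos_lt|].
  apply sqrt_lt_R0; destruct (line_nz d); nra.
Qed.

(* A point of the parabola lies on the same side of the directrix as the focus:
   otherwise its distances to them would differ by at least that of the focus
   to the directrix. *)
Lemma parabola_focal (F : point) (d : line) :
  ~ on_line d F ->
  exists u : point, fst u ^ 2 + snd u ^ 2 = 1 /\
    forall X, parabola F d X ->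
      pdist X F = parabola_semi_latus_rectum F d + inner_from F u X.
Proof.
  intros HF; pose proof (semi_latus_rectum_gt0 F d HF) as Hp.
  unfold parabola, parabola_semi_latus_rectum, dist_line in *.
  assert (H2 : 0 < la d ^ 2 + lb d ^ 2) by (destruct (line_nz d); nra).
  pose proof (pow2_sqrt _ (Rlt_le _ _ H2)) as HN2.
  pose proof (sqrt_lt_R0 _ H2) as HN.
  set (N := sqrt (la d ^ 2 + lb d ^ 2)) in *.
  (* The sign [s] orients the unit normal [u] of the directrix towards the side of the focus, so
     that [s * line_eval d X / N] is the signed distance, positive on that side. *)
  assert (exists s, s ^ 2 = 1 /\ Rabs (line_eval d F) = s * line_eval d F)
    as (s & Hs & HsF).
  { destruct (Rle_dec 0 (line_eval d F)).
    - exists 1; rewrite Rabs_pos_eq by assumption; lra.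
    - exists (-1); rewrite Rabs_left by lra; lra. }
  set (u := (s * la d / N, s * lb d / N)).
  assert (Hu : fst u ^ 2 + snd u ^ 2 = 1).
  { simpl fst; simpl snd.
    replace ((s * la d / N) ^ 2 + (s * lb d / N) ^ 2)
      with (s ^ 2 * (la d ^ 2 + lb d ^ 2) / N ^ 2) by (field; lra).
    rewrite Hs, HN2; field; lra. }
  exists u; split; [exact Hu|]; intros X HX.
  assert (Hl : s * line_eval d X / N
               = Rabs (line_eval d F) / N + inner_from F u X).
  { rewrite HsF; unfold inner_from, line_eval, u; simpl fst; simpl snd; field; lra. }
  rewrite <- Hl.
  assert (Habs : Rabs (line_eval d X) = s * line_eval d X
                 \/ Rabs (line_eval d X) = - (s * line_eval d X)).
  { assert (s = 1 \/ s = -1) as [-> | ->]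
      by (destruct (Rmult_integral (s - 1) (s + 1)); [nra | left; lra | right; lra]).
    all: destruct (Rcase_abs (line_eval d X));
      [rewrite Rabs_left by lra | rewrite Rabs_right by lra]; lra. }
  destruct Habs as [E | E]; [rewrite <- E; exact HX|exfalso].
  pose proof (pdist_ge0 X F) as H0.
  rewrite E in HX.
  replace (- (s * line_eval d X) / N) with (- (s * line_eval d X / N)) in HX
    by (field; lra).
  rewrite Hl in HX.
  (* On the far side [- inner_from F u X] would be [pdist X F] plus the positive semi-latus rectum,
     too large for a unit vector [u]. *)
  assert (HC : inner_from F u X ^ 2 <= pdist X F ^ 2).
  { rewrite pdist_sqr, <- (Rmult_1_l (_ + _)), <- Hu; apply cauchy_schwarz. }
  nra.
Qed.

(** Rotation about [F] preserves distances to [F] and inner products of vectors from [F]. The free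
    vector [u] is turned about the origin. *)
Lemma rotated_focal (F u : point) (p theta : R) (S : point -> Prop) (X : point) :
  (forall Y, S Y -> pdist Y F = p + inner_from F u Y) ->
  rotated F theta S X ->
  pdist X F = p + inner_from F (rotate (0, 0) theta u) X.
Proof.
  intros HS (Y & HY & ->).
  pose proof (sin2_cos2 theta) as Ht; unfold Rsqr in Ht.
  replace (pdist (rotate F theta Y) F) with (pdist Y F).
  - rewrite (HS Y HY); f_equal; unfold inner_from, rotate; simpl fst; simpl snd.
    set (x := fst Y - fst F); set (y := snd Y - snd F).
    transitivity ((sin theta * sin theta + cos theta * cos theta)
                  * (fst u * x + snd u * y)); [rewrite Ht|unfold x, y]; ring.
  - rewrite <- (sqrt_pow2 (pdist Y F)), <- (sqrt_pow2 (pdist (rotate F theta Y) F))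
      by apply pdist_ge0.
    f_equal; rewrite !pdist_sqr; unfold rotate; simpl fst; simpl snd.
    set (x := fst Y - fst F); set (y := snd Y - snd F).
    transitivity ((sin theta * sin theta + cos theta * cos theta) * (x ^ 2 + y ^ 2));
      [rewrite Ht|unfold x, y]; ring.
Qed.

Lemma rotate_unit (theta : R) (u : point) :
  fst u ^ 2 + snd u ^ 2 = 1 ->
  fst (rotate (0, 0) theta u) ^ 2 + snd (rotate (0, 0) theta u) ^ 2 = 1.
Proof.
  intros Hu; pose proof (sin2_cos2 theta) as Ht; unfold Rsqr in Ht.
  unfold rotate; simpl fst; simpl snd.
  transitivity ((sin theta * sin theta + cos theta * cos theta)
                * (fst u ^ 2 + snd u ^ 2)); [ring | rewrite Ht, Hu; ring].
Qed.

(** * The enveloping conic and its points of contact *)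

(** [m] is the value of [k + inner_from F e X] at the origin. The squared equation covers both signs
    of [k]. *)
Definition focal_conic (F e : point) (k : R) : quadric :=
  let m := k - fst e * fst F - snd e * snd F in
  {| qxx := 1 - fst e ^ 2; qxy := - (fst e * snd e); qyy := 1 - snd e ^ 2;
     qx := - fst F - m * fst e; qy := - snd F - m * snd e;
     q0 := fst F ^ 2 + snd F ^ 2 - m ^ 2 |}.

Lemma focal_conic_eval (F e : point) (k : R) (X : point) :
  quadric_eval (focal_conic F e k) X
  = (fst X - fst F) ^ 2 + (snd X - snd F) ^ 2 - (k + inner_from F e X) ^ 2.
Proof. unfold quadric_eval, focal_conic, inner_from; simpl; ring. Qed.

Lemma focal_conic_grad (F e : point) (k : R) (X : point) :
  quadric_grad (focal_conic F e k) X
  = (2 * (fst X - fst F - (k + inner_from F e X) * fst e),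
     2 * (snd X - snd F - (k + inner_from F e X) * snd e)).
Proof. unfold quadric_grad, focal_conic, inner_from; simpl; f_equal; ring. Qed.

(** Degeneracy thus depends on [k] alone, which gives the two cases of the theorem. *)
Lemma focal_conic_det (F e : point) (k : R) :
  quadric_det (focal_conic F e k) = - k ^ 2.
Proof. unfold quadric_det, focal_conic; simpl; ring. Qed.

(** This keeps the denominator of the contact point positive. *)
Lemma inner_lt1 (e u : point) :
  fst e ^ 2 + snd e ^ 2 < 1 -> fst u ^ 2 + snd u ^ 2 = 1 ->
  fst e * fst u + snd e * snd u < 1.
Proof.
  intros He Hu; pose proof (cauchy_schwarz (fst e) (snd e) (fst u) (snd u)) as H.
  rewrite Hu in H; nra.
Qed.

(** At [F + t u] the equation [t = k + inner_from F e X] reads [t = k + t (e.u)], whence this [t],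
    negative when [k < 0]. *)
Definition contact_point (F e u : point) (k : R) : point :=
  let t := k / (1 - (fst e * fst u + snd e * snd u)) in
  (fst F + t * fst u, snd F + t * snd u).

Lemma contact_point_inner (F e u : point) (k : R) :
  fst e ^ 2 + snd e ^ 2 < 1 -> fst u ^ 2 + snd u ^ 2 = 1 ->
  k + inner_from F e (contact_point F e u k)
  = k / (1 - (fst e * fst u + snd e * snd u)).
Proof.
  intros He Hu; pose proof (inner_lt1 e u He Hu).
  unfold inner_from, contact_point; simpl fst; simpl snd; field; lra.
Qed.

Lemma contact_point_on_conic (F e u : point) (k : R) :
  fst e ^ 2 + snd e ^ 2 < 1 -> fst u ^ 2 + snd u ^ 2 = 1 ->
  on_quadric (focal_conic F e k) (contact_point F e u k).
Proof.
  intros He Hu; unfold on_quadric.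
  rewrite focal_conic_eval, contact_point_inner by assumption.
  unfold contact_point; simpl fst; simpl snd.
  set (t := k / _).
  transitivity (t ^ 2 * (fst u ^ 2 + snd u ^ 2 - 1)); [|rewrite Hu]; ring.
Qed.

Lemma focal_conic_proper (F e : point) (k : R) :
  fst e ^ 2 + snd e ^ 2 < 1 -> k <> 0 -> proper_conic (focal_conic F e k).
Proof.
  intros He Hk; split.
  - rewrite focal_conic_det; nra.
  - exists (contact_point F e (1, 0) k).
    apply contact_point_on_conic; [exact He | simpl; ring].
Qed.

(** For [k = 0] the equation makes [|X - F|^2] equal to [(e.(X - F))^2], which is at most
    [|e|^2 |X - F|^2]; as [|e| < 1], this forces [X = F]. *)
Lemma focal_conic_point (F e : point) :
  fst e ^ 2 + snd e ^ 2 < 1 -> point_conic F (focal_conic F e 0).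
Proof.
  intros He X; unfold on_quadric; rewrite focal_conic_eval; split.
  - unfold inner_from; intros HX.
    pose proof (cauchy_schwarz (fst e) (snd e) (fst X - fst F) (snd X - snd F)) as H.
    destruct X as [x y], F as [f g]; simpl fst in *; simpl snd in *.
    assert (H0 : (x - f) ^ 2 + (y - g) ^ 2 = 0)
      by (pose proof (pow2_ge_0 (x - f)); pose proof (pow2_ge_0 (y - g)); nra).
    rewrite <- !Rsqr_pow2 in H0; apply Rplus_sqr_eq_0 in H0.
    f_equal; lra.
  - intros ->; unfold inner_from; ring.
Qed.

(** * Tangency of the common chord *)

(** The vector [n = u - e] is normal to the chord. The contact point satisfies the chord's equation,
    and the gradient there is [2 t n]; for [k = 0] it vanishes. *)
Lemma chord_tangent (F e u : point) (k : R) (A B : point) (chord : line) :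
  fst e ^ 2 + snd e ^ 2 < 1 -> fst u ^ 2 + snd u ^ 2 = 1 ->
  A <> B ->
  inner_from F u A - inner_from F e A = k ->
  inner_from F u B - inner_from F e B = k ->
  on_line chord A -> on_line chord B ->
  tangent chord (focal_conic F e k).
Proof.
  intros He Hu HAB HA HB HcA HcB.
  pose proof (inner_lt1 e u He Hu) as Heu.
  set (nx := fst u - fst e); set (ny := snd u - snd e).
  (* [u] and [e] differ because [|e| < 1 = |u|]. *)
  assert (Hn : nx <> 0 \/ ny <> 0).
  { destruct (Req_dec nx 0) as [Hx|]; [|now left].
    right; intros Hy; unfold nx, ny in *.
    replace (fst e) with (fst u) in He by lra.
    replace (snd e) with (snd u) in He by lra.
    lra. }
  assert (HvAB : fst A - fst B <> 0 \/ snd A - snd B <> 0).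
  { destruct (Req_dec (fst A - fst B) 0) as [Hx|]; [|now left].
    right; intros Hy; apply HAB.
    destruct A, B; simpl in *; f_equal; lra. }
  unfold on_line, line_eval in HcA, HcB; unfold inner_from in HA, HB.
  (* Both [n] and the coefficient vector of [chord] are orthogonal to [A - B], which is nonzero. *)
  assert (Hpar : nx * lb chord = ny * la chord)
    by (apply (orthogonal_parallel (fst A - fst B) (snd A - snd B));
        [exact HvAB | unfold nx, ny; lra | lra]).
  exists (contact_point F e u k); split; [|split].
  - set (T := contact_point F e u k).
    (* Since [u.u = 1], [n.(T - F) = t (1 - e.u) = k], the same value as at [A]. *)
    assert (HT : nx * (fst T - fst A) + ny * (snd T - snd A) = 0).
    { transitivity (nx * (fst T - fst F) + ny * (snd T - snd F) - k);
        [rewrite <- HA; unfold nx, ny; ring|].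
      unfold T, contact_point, nx, ny; simpl fst; simpl snd.
      set (q := fst e * fst u + snd e * snd u) in *.
      transitivity (k / (1 - q) * (fst u ^ 2 + snd u ^ 2 - q) - k);
        [unfold q; ring | rewrite Hu; field; lra]. }
    assert (H : la chord * (fst T - fst A) = - lb chord * (snd T - snd A)).
    { apply Rminus_diag_uniq.
      destruct Hn as [Hn | Hn].
      - apply (Rmult_eq_reg_l nx); [|exact Hn].
        transitivity (la chord * (nx * (fst T - fst A) + ny * (snd T - snd A))
          + (nx * lb chord - ny * la chord) * (snd T - snd A)); [ring|].
        rewrite HT, Hpar; ring.
      - apply (Rmult_eq_reg_l ny); [|exact Hn].
        transitivity (lb chord * (nx * (fst T - fst A) + ny * (snd T - snd A))
          - (nx * lb chord - ny * la chord) * (fst T - fst A)); [ring|].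
        rewrite HT, Hpar; ring. }
    unfold on_line, line_eval; lra.
  - now apply contact_point_on_conic.
  - rewrite focal_conic_grad, contact_point_inner by assumption.
    unfold contact_point; simpl fst; simpl snd.
    set (t := k / _).
    transitivity (- 2 * t * (nx * lb chord - ny * la chord));
      [unfold nx, ny | rewrite Hpar]; ring.
Qed.

Theorem theorem4
  (F F' : point) (a : R) (d : line)
  (Heps : pdist F F' < 2 * a)
  (Hp : ~ on_line d F) :
  exists gamma : quadric,
    (proper_conic gamma \/
     (ellipse_semi_latus_rectum F F' a = parabola_semi_latus_rectum F d /\
      point_conic F gamma)) /\
    forall (theta : R) (A B : point),
      A <> B ->
      ellipse F F' a A -> rotated F theta (parabola F d) A ->
      ellipse F F' a B -> rotated F theta (parabola F d) B ->
      forall chord : line,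
        on_line chord A -> on_line chord B -> tangent chord gamma.
Proof.
  assert (Ha : 0 < a) by (pose proof (pdist_ge0 F F'); lra).
  pose proof (eccentricity_lt1 F F' a Heps) as He.
  (* [k] does not involve [theta], so one conic serves all positions of the parabola. *)
  set (k := ellipse_semi_latus_rectum F F' a - parabola_semi_latus_rectum F d).
  exists (focal_conic F (eccentricity_vector F F' a) k); split.
  - destruct (Req_dec k 0) as [Hk | Hk].
    + right; split; [unfold k in Hk; lra|].
      rewrite Hk; now apply focal_conic_point.
    + left; now apply focal_conic_proper.
  - intros theta A B HAB HeA HpA HeB HpB chord HcA HcB.
    destruct (parabola_focal F d Hp) as (u & Hu & Hfoc).
    apply ellipse_focal in HeA, HeB; try exact Ha.
    apply (rotated_focal _ _ _ _ _ _ Hfoc) in HpA, HpB.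
    (* Subtracting the two focal equations at [A] and at [B] gives the two equations of the
       chord. *)
    apply (chord_tangent F _ (rotate (0, 0) theta u) k A B);
      try assumption; [now apply rotate_unit | unfold k; lra | unfold k; lra].
Qed.
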